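(* Let $B\subseteq A$ be an extension of $\Bbbk$-algebras such that $J(B)$ is a two-sided ideal of $A$. Then $B\subseteq A$ is controllable, i.e. $\operatorname{gldim}(A,B)=\operatorname{gldim}\bigl(A/AJ(B)A\bigr)$.
   Context: Throughout, $\Bbbk$ is a perfect field and all algebras are Artin algebras over $\Bbbk$ (finite-dimensional, associative, unital). An extension $B\subseteq A$ is an algebra $A$ with a unital subalgebra $B$. $J(A)$ is the Jacobson radical, and $A\text{-mod}$ is the category of finitely generated left $A$-modules. $\operatorname{gldim}(C)$ is the ordinary global dimension of an algebra $C$. A module $M\in A\text{-mod}$ is $(A,B)$-projective if the multiplication map $A\otimes_B M\to M$ is a split epimorphism of $A$-modules (equivalently, $M$ is a direct summand of $A\otimes_B X$ for some $B$-module $X$). An $(A,B)$-exact sequence is a complex of $A$-modules $(M_n,d_n)$ admitting a $B$-homotopy, i.e. $B$-linear maps $h_n:M_n\to M_{n+1}$ with $d_{n+1}h_n+h_{n-1}d_n=1_{M_n}$ for all $n$. An $(A,B)$-projective resolution of $M$ is an $(A,B)$-exact sequence $\cdots\to P_1\to P_0\to M\to 0$ with all $P_i$ being $(A,B)$-projective. $\operatorname{pd}_{(A,B)}M$ is the least length of such a resolution (of $P_\bullet$), or $\infty$, and $\operatorname{gldim}(A,B)=\sup\{\operatorname{pd}_{(A,B)}M : M\in A\text{-mod}\}$. The extension $B\subseteq A$ is called controllable if $\operatorname{gldim}(A,B)=\operatorname{gldim}(A/AJ(B)A)$, where $AJ(B)A$ is the two-sided ideal of $A$ generated by $J(B)$.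 *)

(* Defs.v *)
From HB Require Import structures.
From mathcomp Require Import all_boot all_order all_algebra all_field.
From mathcomp Require Import generic_quotient ring_quotient.
From mathcomp Require Import boolp classical_sets.
From mathcomp Require Import freeg.

Set Implicit Arguments.
Unset Strict Implicit.
Unset Printing Implicit Defensive.

Import GRing.Theory.

Local Open Scope ring_scope.
Local Open Scope quotient_scope.
Local Open Scope classical_set_scope.

Definition perfect_field (k : fieldType) : Prop :=
  forall p : {poly k}, irreducible_poly p -> separable_poly p.

(* Dimensions live in nat with infinity adjoined as None. *)
Definition enat := option nat.

Definition enat_le (x : enat) (n : nat) : bool :=
  if x is Some m then (m <= n)%N else false.

Definition enat_inf (S : set nat) : enat :=
  match pselect (exists n, `[< S n >]) with
  | left exS => Some (ex_minn exS)
  | right _ => None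
  end.

Definition enat_sup (S : set enat) : enat :=
  enat_inf [set n | forall x, S x -> enat_le x n].

Section Subgroups.
Variables (V : zmodType) (S : set V).

Definition subgroup (G : set V) : Prop :=
  G 0 /\ forall x y, G x -> G y -> G (x - y).

Definition subgroup_gen : {pred V} :=
  fun x => `[< forall G : set V, subgroup G -> S `<=` G -> G x >].

Fact subgroup_gen_closed : zmod_closed subgroup_gen.
Proof.
split=> [|x y /asboolP Gx /asboolP Gy]; apply/asboolP=> G sG SG.
  by case: sG.
by apply: (sG.2); [apply: Gx | apply: Gy].
Qed.

HB.instance Definition _ :=
  GRing.isZmodClosed.Build V subgroup_gen subgroup_gen_closed.

End Subgroups.

Section Ideals.
Variable R : pzRingType.

Definition left_ideal (I : set R) : Prop :=
  subgroup I /\ forall a x, I x -> I (a * x).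

Definition two_sided_ideal (I : set R) : Prop :=
  left_ideal I /\ forall a x, I x -> I (x * a).

Definition maximal_left_ideal (I : set R) : Prop :=
  [/\ left_ideal I, I <> setT &
      forall L : set R, left_ideal L -> I `<=` L -> L = I \/ L = setT].

Definition jacobson : set R :=
  [set x | forall I : set R, maximal_left_ideal I -> I x].

Definition ideal_gen (S : set R) : {pred R} :=
  fun x => `[< forall I : set R, two_sided_ideal I -> S `<=` I -> I x >].

Fact ideal_gen_closed S : zmod_closed (ideal_gen S).
Proof.
split=> [|x y /asboolP Ix /asboolP Iy]; apply/asboolP=> I sI SI.
  by case: sI.1.1.
by apply: (sI.1.1.2); [apply: Ix | apply: Iy].
Qed.

HB.instance Definition _ S :=
  GRing.isZmodClosed.Build R (ideal_gen S) (ideal_gen_closed S).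

Fact ideal_genMl S a x : x \in ideal_gen S -> a * x \in ideal_gen S.
Proof. by move=> /asboolP Ix; apply/asboolP=> I sI SI; apply: sI.1.2; exact: Ix. Qed.

Fact ideal_genMr S a x : x \in ideal_gen S -> x * a \in ideal_gen S.
Proof. by move=> /asboolP Ix; apply/asboolP=> I sI SI; apply: sI.2; exact: Ix. Qed.

End Ideals.

Arguments jacobson R : clear implicits.

(* R modulo the two-sided ideal generated by S. {ideal_quot I} carries a ring  *)
(* structure in the library only when R is commutative.                       *)
Section QuotientRing.
Variables (R : pzRingType) (S : set R).

Definition quotring := {ideal_quot (ideal_gen S)}.

HB.instance Definition _ := GRing.Zmodule.on quotring.
HB.instance Definition _ := EqQuotient.on quotring.

Definition quotring_one : quotring := lift_cst quotring 1.
Definition quotring_mul := lift_op2 quotring *%R.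

Lemma pi_quotring_mul :
  {morph \pi_quotring : x y / x * y >-> quotring_mul x y}.
Proof.
move=> x y; unlock quotring_mul; apply/eqP.
rewrite -Quotient.idealrBE.
have modE z : z - repr (\pi_quotring z) \in ideal_gen S.
  by rewrite Quotient.idealrBE reprK.
rewrite -[x * y](addrNK (x * repr (\pi_quotring y))) -mulrBr -addrA -mulrBl.
by apply: rpredD; [apply: ideal_genMl | apply: ideal_genMr]; apply: modE.
Qed.

Let mulE (x y : R) :
  quotring_mul (\pi_quotring x) (\pi_quotring y) = \pi_quotring (x * y).
Proof. by rewrite pi_quotring_mul. Qed.

Let addE (x y : R) : \pi_quotring x + \pi_quotring y = \pi_quotring (x + y).
Proof. by rewrite pi_addr. Qed.

Let oneE : quotring_one = \pi_quotring 1.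
Proof. by unlock quotring_one. Qed.

Fact quotring_mulA : associative quotring_mul.
Proof.
by move=> x y z; rewrite -[x]reprK -[y]reprK -[z]reprK !mulE mulrA.
Qed.

Fact quotring_mul1r : left_id quotring_one quotring_mul.
Proof. by move=> x; rewrite -[x]reprK oneE mulE mul1r. Qed.

Fact quotring_mulr1 : right_id quotring_one quotring_mul.
Proof. by move=> x; rewrite -[x]reprK oneE mulE mulr1. Qed.

Fact quotring_mulDl : left_distributive quotring_mul +%R.
Proof.
by move=> x y z; rewrite -[x]reprK -[y]reprK -[z]reprK !(addE, mulE) mulrDl.
Qed.

Fact quotring_mulDr : right_distributive quotring_mul +%R.
Proof.
by move=> x y z; rewrite -[x]reprK -[y]reprK -[z]reprK !(addE, mulE) mulrDr.
Qed.

HB.instance Definition _ := GRing.Zmodule_isPzRing.Build quotring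
  quotring_mulA quotring_mul1r quotring_mulr1 quotring_mulDl quotring_mulDr.

End QuotientRing.

Section MorphB.
Variables (U V : zmodType) (f : U -> V) (fB : {morph f : x y / x - y}).

Lemma morphB0 : f 0 = 0.
Proof. by have := fB 0 0; rewrite !subrr. Qed.

Lemma morphBN : {morph f : x / - x}.
Proof. by move=> x; rewrite -sub0r fB morphB0 sub0r. Qed.

Lemma morphBD : {morph f : x y / x + y}.
Proof. by move=> x y; rewrite -{1}[y]opprK fB morphBN opprK. Qed.

End MorphB.

(* A (x)_B M for an A-module M: the free abelian group on the pairs (a, m)     *)
(* modulo biadditivity and (a b) (x) m = a (x) (b m).                          *)
Section Tensor.
Variables (A : pzRingType) (B : {pred A}) (M : lmodType A).

Local Notation F := {freeg (A * M)%type / int}.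
Local Notation gen a m := (<< ((a, m) : A * M) >> : F).

Definition tensor_rel : set F := [set r |
  [\/ exists a a' m, r = gen (a + a') m - (gen a m + gen a' m),
      exists a m m', r = gen a (m + m') - (gen a m + gen a m') |
      exists a b m, b \in B /\ r = gen (a * b) m - gen a (b *: m)]].

Definition tensor := {ideal_quot (subgroup_gen tensor_rel)}.

HB.instance Definition _ := GRing.Zmodule.on tensor.
HB.instance Definition _ := EqQuotient.on tensor.

Let lift_additive (V : zmodType) (f : A * M -> zmodule V) :
  {morph fglift f : x y / x - y >-> x - y}.
Proof. exact: lift_is_additive. Qed.

Let liftE (V : zmodType) (f : A * M -> zmodule V) a m : fglift f (gen a m) = f (a, m).
Proof. by rewrite liftU scale1r. Qed.

Lemma freeg_eq (V : zmodType) (f g : F -> V) :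
    {morph f : x y / x - y} -> {morph g : x y / x - y} ->
  (forall a m, f (gen a m) = g (gen a m)) -> f =1 g.
Proof.
move=> fB gB fg; pose h x := f x - g x.
have hB : {morph h : x y / x - y}.
  by move=> x y; rewrite /h fB gB !opprD addrACA.
have hN := morphBN hB; have hD := morphBD hB.
have hgen c p : h << c *g p >> = 0.
  have hnat n : h << n%:Z *g p >> = 0.
    elim: n => [|n IHn]; first by rewrite freegU0 (morphB0 hB).
    rewrite -addn1 PoszD -freegUD hD IHn add0r; case: p {IHn} => a m.
    by rewrite /h fg subrr.
  by case: c => n; rewrite ?NegzE -?freegUN ?hN hnat ?oppr0.
move=> x; apply/eqP; rewrite -subr_eq0 -/(h x); apply/eqP.
elim/(@freeg_ind_dom0 int): x => [|c p D _ _ IH]; first exact: morphB0 hB.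
by rewrite hD hgen IH addr0.
Qed.

Definition pretensor_scale (a : A) : F -> F :=
  fglift (fun p : A * M => gen (a * p.1) p.2 : zmodule F).

Definition pretensor_mul : F -> M := fglift (fun p : A * M => p.1 *: p.2 : zmodule M).

Let gen_rel r : tensor_rel r -> r \in subgroup_gen tensor_rel.
Proof. by move=> rr; apply/asboolP=> G _; apply. Qed.

Let lift_rel (V : zmodType) (I : set V) (f : F -> V) :
    subgroup I -> {morph f : x y / x - y} -> (forall r, tensor_rel r -> I (f r)) ->
  forall x, x \in subgroup_gen tensor_rel -> I (f x).
Proof.
move=> [I0 IB] fB fI x /asboolP Gx; apply: (Gx [set y | I (f y)]) => //.
split=> [|u v /= Iu Iv] /=.
  by rewrite (morphB0 fB).
by rewrite fB; apply: IB.
Qed.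

Let scaleB a : {morph pretensor_scale a : x y / x - y}.
Proof. exact: lift_additive. Qed.

Let mulB : {morph pretensor_mul : x y / x - y}.
Proof. exact: lift_additive. Qed.

Let scaleE a a' m : pretensor_scale a (gen a' m) = gen (a * a') m.
Proof. exact: liftE. Qed.

Let mulE a m : pretensor_mul (gen a m) = a *: m.
Proof. exact: liftE. Qed.

Let scale_rel a x :
  x \in subgroup_gen tensor_rel ->
  pretensor_scale a x \in subgroup_gen tensor_rel.
Proof.
have sG : subgroup [set y | y \in subgroup_gen tensor_rel].
  by split=> [|u v]; [apply: rpred0 | apply: rpredB].
apply: (lift_rel sG (scaleB a)) => r rr; apply: gen_rel.
case: rr => [[b [b' [m ->]]]|[b [m [m' ->]]]|[b [c [m [Bc ->]]]]].
- rewrite scaleB (morphBD (scaleB a)) !scaleE mulrDr.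
  by apply: Or31; exists (a * b), (a * b'), m.
- rewrite scaleB (morphBD (scaleB a)) !scaleE.
  by apply: Or32; exists (a * b), m, m'.
- rewrite scaleB !scaleE mulrA.
  by apply: Or33; exists (a * b), c, m.
Qed.

Let mul_rel x : x \in subgroup_gen tensor_rel -> pretensor_mul x = 0.
Proof.
have sG : subgroup [set y : M | y = 0].
  by split=> [|u v -> ->] //=; rewrite subr0.
apply: (lift_rel sG mulB) => r /=.
case=> [[b [b' [m ->]]]|[b [m [m' ->]]]|[b [c [m [Bc ->]]]]];
  rewrite mulB ?(morphBD mulB) !mulE.
- by rewrite scalerDl subrr.
- by rewrite scalerDr subrr.
- by rewrite scalerA subrr.
Qed.

Let piP (x y : F) : x - y \in subgroup_gen tensor_rel ->
  \pi_tensor x = \pi_tensor y.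
Proof. by rewrite Quotient.idealrBE => /eqP. Qed.

Let reprP (x : F) : x - repr (\pi_tensor x) \in subgroup_gen tensor_rel.
Proof. by rewrite Quotient.idealrBE reprK. Qed.

Let piD (x y : F) : \pi_tensor (x + y) = \pi_tensor x + \pi_tensor y.
Proof. exact: pi_addr. Qed.

Definition ptensor (a : A) (m : M) : tensor := \pi_tensor (gen a m).

Definition tensor_scale (a : A) (t : tensor) : tensor :=
  \pi_tensor (pretensor_scale a (repr t)).

Definition tensor_mul (t : tensor) : M := pretensor_mul (repr t).

Let tensor_scale_pi a x :
  tensor_scale a (\pi_tensor x) = \pi_tensor (pretensor_scale a x).
Proof. by apply/esym/piP; rewrite -scaleB scale_rel. Qed.

Let tensor_mul_pi x : tensor_mul (\pi_tensor x) = pretensor_mul x.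
Proof. by apply/esym/eqP; rewrite -subr_eq0 -mulB mul_rel. Qed.

Lemma tensor_scaleE a a' m :
  tensor_scale a (ptensor a' m) = ptensor (a * a') m.
Proof. by rewrite tensor_scale_pi scaleE. Qed.

Lemma tensor_mulE a m : tensor_mul (ptensor a m) = a *: m.
Proof. by rewrite tensor_mul_pi mulE. Qed.

Lemma ptensorDl a a' m : ptensor (a + a') m = ptensor a m + ptensor a' m.
Proof.
by rewrite -piD; apply/piP/gen_rel/Or31; exists a, a', m.
Qed.

Lemma ptensorDr a m m' : ptensor a (m + m') = ptensor a m + ptensor a m'.
Proof.
by rewrite -piD; apply/piP/gen_rel/Or32; exists a, m, m'.
Qed.

Lemma ptensorM a b m : b \in B -> ptensor (a * b) m = ptensor a (b *: m).
Proof. by move=> Bb; apply/piP/gen_rel/Or33; exists a, b, m. Qed.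

Let piB : {morph \pi_tensor : x y / x - y}.
Proof. by move=> x y; rewrite pi_addr pi_oppr. Qed.

Lemma tensor_eq (V : zmodType) (f g : tensor -> V) :
    {morph f : x y / x - y} -> {morph g : x y / x - y} ->
  (forall a m, f (ptensor a m) = g (ptensor a m)) -> f =1 g.
Proof.
move=> fB gB fg t; rewrite -[t]reprK.
apply: (@freeg_eq V (f \o \pi_tensor) (g \o \pi_tensor)) => // x y /=.
  by rewrite piB fB.
by rewrite piB gB.
Qed.

Let tscaleB a : {morph tensor_scale a : x y / x - y}.
Proof.
move=> x y; rewrite -[x]reprK -[y]reprK -piB !tensor_scale_pi -piB.
by rewrite scaleB.
Qed.

Fact tensor_scaleDr : right_distributive tensor_scale +%R.
Proof.
by move=> a x y; rewrite (morphBD (tscaleB a)).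
Qed.

Fact tensor_scaleA a b t :
  tensor_scale a (tensor_scale b t) = tensor_scale (a * b) t.
Proof.
apply: (@tensor_eq _ (tensor_scale a \o tensor_scale b)) => [x y|x y|c m] /=.
- by rewrite !tscaleB.
- by rewrite tscaleB.
- by rewrite !tensor_scaleE mulrA.
Qed.

Fact tensor_scale1 : left_id 1 tensor_scale.
Proof.
move=> t; apply: (@tensor_eq _ (tensor_scale 1) idfun) => [x y|//|c m].
  by rewrite tscaleB.
by rewrite tensor_scaleE mul1r.
Qed.

Fact tensor_scaleDl t : {morph tensor_scale^~ t : a b / a + b}.
Proof.
move=> a b; apply: (@tensor_eq _ _ (fun t => tensor_scale a t + tensor_scale b t)).
- exact: tscaleB.
- by move=> x y /=; rewrite !tscaleB opprD addrACA.
- by move=> c m /=; rewrite !tensor_scaleE mulrDl ptensorDl.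
Qed.

HB.instance Definition _ := GRing.Zmodule_isLmodule.Build A tensor
  tensor_scaleA tensor_scale1 tensor_scaleDr tensor_scaleDl.

Let tmulB : {morph tensor_mul : x y / x - y}.
Proof.
by move=> x y; rewrite -[x]reprK -[y]reprK -piB !tensor_mul_pi mulB.
Qed.

Fact tensor_mul_linear : linear tensor_mul.
Proof.
have tZ a t : tensor_mul (a *: t) = a *: tensor_mul t.
  apply: (@tensor_eq _ (tensor_mul \o ( *:%R a)) (fun t => a *: tensor_mul t)).
  - by move=> x y /=; rewrite scalerBr tmulB.
  - by move=> x y; rewrite tmulB scalerBr.
  - by move=> c m /=; rewrite [_ *: _]tensor_scaleE !tensor_mulE scalerA.
by move=> a x y; rewrite (morphBD tmulB) tZ.
Qed.

HB.instance Definition _ :=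
  GRing.isLinear.Build A tensor M *:%R tensor_mul tensor_mul_linear.

End Tensor.

Section Dimensions.
Variable R : pzRingType.

Definition fin_gen (M : lmodType R) : Prop :=
  exists s : seq M, forall x : M,
    exists c : 'I_(size s) -> R, x = \sum_(i < size s) c i *: s`_i.

Definition augment (M : lmodType R) (P : nat -> lmodType R) (n : nat) :
  lmodType R := if n is i.+1 then P i else M.

(* The sequences below are ... -> X 1 -> X 0 -> 0; in the augmented sequence   *)
(* of a resolution of M, X 0 is M and X i.+1 is the term of degree i.          *)
Definition is_complex (X : nat -> lmodType R)
    (d : forall n, {linear X n.+1 -> X n}) : Prop :=
  forall n x, d n (d n.+1 x) = 0.

Definition is_exact (X : nat -> lmodType R)
    (d : forall n, {linear X n.+1 -> X n}) : Prop :=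
  [/\ is_complex d, forall x, exists y, d 0%N y = x &
      forall n x, d n x = 0 -> exists y, d n.+1 y = x].

(* The terms of resolutions are finitely generated: everything takes place in  *)
(* the category of finitely generated modules.                                *)
Definition is_resolution (proj : lmodType R -> Prop)
    (exact : forall X : nat -> lmodType R,
       (forall n, {linear X n.+1 -> X n}) -> Prop)
    (M : lmodType R) (P : nat -> lmodType R) : Prop :=
  (forall i, fin_gen (P i) /\ proj (P i)) /\
  exists d : forall n, {linear augment M P n.+1 -> augment M P n}, exact _ d.

Definition proj_dim proj exact (M : lmodType R) : enat :=
  enat_inf [set n | exists P, is_resolution proj exact M P /\
                      forall i, (n < i)%N -> forall x : P i, x = 0].

Definition global_dim proj exact : enat :=
  enat_sup [set e | exists2 M, fin_gen M & e = proj_dim proj exact M].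

Definition projective (P : lmodType R) : Prop :=
  forall (N N' : lmodType R) (g : {linear N -> N'}) (f : {linear P -> N'}),
    (forall y, exists x, g x = y) ->
    exists f' : {linear P -> N}, forall x, g (f' x) = f x.

Definition gldim : enat := global_dim projective is_exact.

End Dimensions.

Section RelativeDimensions.
Variables (A : pzRingType) (B : {pred A}).

Definition rel_projective (M : lmodType A) : Prop :=
  exists s : {linear M -> tensor B M}, forall x, tensor_mul (s x) = x.

Definition rel_linear (M N : lmodType A) (h : M -> N) : Prop :=
  (forall x y, h (x + y) = h x + h y) /\
  (forall b x, b \in B -> h (b *: x) = b *: h x).

Definition rel_exact (X : nat -> lmodType A)
    (d : forall n, {linear X n.+1 -> X n}) : Prop :=
  is_complex d /\
  exists h : forall n, X n -> X n.+1,
    [/\ forall n, rel_linear (h n),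
        forall x, d 0%N (h 0%N x) = x &
        forall n x, d n.+1 (h n.+1 x) + h n (d n x) = x].

Definition rel_gldim : enat := global_dim rel_projective rel_exact.

End RelativeDimensions.

(* The identity of B : {aspace A} may differ from 1 : A, so B is a unital      *)
(* subalgebra of A only under the extra hypothesis 1 \in B.                    *)
Section Controllable.
Variables (k : fieldType) (A : falgType k) (B : {aspace A}).

Definition jacobson_sub : set A := vsval @` jacobson (subvs_of B).

Definition controllable : Prop := rel_gldim B = gldim (quotring jacobson_sub).

End Controllable.

(* Main.v *)
(* Write J for J(B) and C for A/J. Since B/J is semisimple, every exact sequence
   of C-modules is (A,B)-exact. An A-module M is compared with the C-module M/JM.
   Reduction modulo J turns an (A,B)-projective resolution of a C-module into a
   C-projective one, because a B-linear homotopy preserves the submodules JX.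
   Conversely, from a projective resolution P of M/JM over C one gets an
   (A,B)-projective resolution of M by replacing P_0 with its fibre product with
   M over M/JM. The point is that an A-module Q with Q/JQ projective over C is
   (A,B)-projective: j (a (x) m) = 1 (x) j a m for j in J, so multiplication
   A (x)_B Q -> Q is injective on J (A (x)_B Q), and a splitting modulo J lifts
   uniquely. *)

From HB Require Import structures.
From mathcomp Require Import all_boot all_order all_algebra all_field.
From mathcomp Require Import generic_quotient ring_quotient.
From mathcomp Require Import boolp classical_sets freeg.
Require Import Defs.

Set Implicit Arguments.
Unset Strict Implicit.
Unset Printing Implicit Defensive.

Import GRing.Theory.

Local Open Scope ring_scope.
Local Open Scope quotient_scope.
Local Open Scope classical_set_scope.

(** * Complements in modules over a semisimple quotient *)

Section LeftIdeals.
Variable R : pzRingType.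
Implicit Types I L : set R.

Lemma left_idealN L x : left_ideal L -> L x -> L (- x).
Proof. by move=> [[L0 LB] _] Lx; rewrite -sub0r; apply: LB. Qed.

Lemma left_idealD L x y : left_ideal L -> L x -> L y -> L (x + y).
Proof.
by move=> lL Lx Ly; rewrite -[y]opprK; apply: lL.1.2 => //; apply: left_idealN.
Qed.

Lemma left_idealI I L : left_ideal I -> left_ideal L -> left_ideal (I `&` L).
Proof.
move=> [[I0 IB] IM] [[L0 LB] LM]; split; first split=> //.
  by move=> x y [Ix Lx] [Iy Ly]; split; [apply: IB | apply: LB].
by move=> a x [Ix Lx]; split; [apply: IM | apply: LM].
Qed.

Definition comaximal I L : Prop := forall x, exists y z, [/\ I y, L z & x = y + z].

(** The sum [L + I] is a left ideal containing [I], so it is [I] or the whole ring; the first would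
    put [L] inside [I]. *)
Lemma maximal_comaximal I L : maximal_left_ideal I -> left_ideal L ->
  ~ L `<=` I -> comaximal L I.
Proof.
move=> [lI _ maxI] lL nLI.
pose K : set R := [set x | exists y z, [/\ L y, I z & x = y + z]].
have lK : left_ideal K.
  split; first split.
  - by exists 0, 0; split; [apply: lL.1.1 | apply: lI.1.1 | rewrite addr0].
  - move=> _ _ [y [z [Ly Iz ->]]] [y' [z' [Ly' Iz' ->]]].
    exists (y - y'), (z - z'); split; [exact: lL.1.2 | exact: lI.1.2 |].
    by rewrite opprD addrACA.
  move=> a _ [y [z [Ly Iz ->]]]; exists (a * y), (a * z).
  by split; [apply: lL.2 | apply: lI.2 | rewrite mulrDr].
case: (maxI K lK) => [x Ix|KI|KT x].
- by exists 0, x; split=> //; [apply: lL.1.1 | rewrite add0r].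
- case: nLI => x Lx; rewrite -KI; exists x, 0.
  by split=> //; [apply: lI.1.1 | rewrite addr0].
- by have : K x by rewrite KT.
Qed.

End LeftIdeals.

(** * Left ideals of a finite-dimensional algebra *)

Section Artinian.
Variables (k : fieldType) (R : falgType k).

(** A subspace of greatest dimension inside [L] is all of [L]: adjoining the line of an element of
    [L] stays in [L], as scalars act by left multiplication. This gives left ideals a dimension to
    minimise. *)
Lemma vspace_of_left_ideal (L : set R) : left_ideal L ->
  exists U : {vspace R}, forall x, x \in U <-> L x.
Proof.
move=> lL.
pose dimL (n : nat) :=
  `[< exists U : {vspace R}, (forall x, x \in U -> L x) /\ \dim U = n >].
have ex_dim : exists n, dimL n.
  exists 0%N; apply/asboolP; exists 0%VS; split; last by rewrite dimv0.
  by move=> x; rewrite memv0 => /eqP ->; apply: lL.1.1.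
have dim_le n : dimL n -> (n <= \dim (fullv : {vspace R}))%N.
  by move=> /asboolP[U [_ <-]]; apply: dimvS; apply: subvf.
have [n /asboolP[U [UL dimU]] max_n] := ex_maxnP ex_dim dim_le.
exists U => x; split=> [|Lx]; first exact: UL.
have UxL y : y \in (U + <[x]>)%VS -> L y.
  move=> /memv_addP[u Uu [_ /vlineP[c ->] ->]].
  by apply: left_idealD => //; [apply: UL | rewrite -mulr_algl; apply: lL.2].
have : (\dim (U + <[x]>) <= \dim U)%N.
  by rewrite dimU; apply: max_n; apply/asboolP; exists (U + <[x]>)%VS.
move=> dimUx.
have /eqP -> : U == (U + <[x]>)%VS by rewrite eqEdim addvSl.
by rewrite -[X in X \in _]add0r memv_add ?mem0v ?memv_line.
Qed.

(* A left ideal of least dimension among those comaximal with [L] meets [L]    *)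
(* inside every maximal left ideal.                                            *)
Lemma left_ideal_complement (L : set R) : left_ideal L ->
  exists L' : set R,
    [/\ left_ideal L', comaximal L L' & L `&` L' `<=` jacobson R].
Proof.
move=> lL.
pose P (n : nat) := `[< exists U : {vspace R},
  [/\ left_ideal [set x | x \in U], comaximal L [set x | x \in U] & \dim U = n] >].
have exP : exists n, P n.
  exists (\dim (fullv : {vspace R})); apply/asboolP; exists fullv; split=> //.
    by split; first split; move=> *; rewrite /= ?memvf.
  move=> x; exists 0, x; split; [exact: lL.1.1|exact: memvf|by rewrite add0r].
have [n /asboolP[U [lU LU dimU]] min_n] := ex_minnP exP.
exists [set x | x \in U]; split=> // x LUx I mI.
(* Otherwise [L] meets [U] in an ideal comaximal with [I], which makes the intersection of [U] and
   [I] comaximal with [L]. Minimality then puts [U] inside [I], although [x] is not in [I]. *)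
apply: contrapT => nIx.
have lLU : left_ideal (L `&` [set x | x \in U]) by exact: left_idealI.
have cLI : comaximal (L `&` [set x | x \in U]) I.
  by apply: maximal_comaximal => // LUI; apply: nIx; apply: LUI.
have lUI : left_ideal ([set x | x \in U] `&` I).
  by apply: left_idealI => //; case: mI.
have [W UW] := vspace_of_left_ideal lUI.
have sWU : (W <= U)%VS by apply/subvP=> y /UW[].
have WUI : [set x | x \in W] = [set x | x \in U] `&` I.
  by apply/seteqP; split=> y /UW.
have dimW : (\dim U <= \dim W)%N.
  rewrite dimU; apply: min_n; apply/asboolP; exists W; split=> //; rewrite WUI //.
  move=> y; have [l [u [Ll Uu ->]]] := LU y.
  have [l' [i [[Ll' Ul'] Ii Eu]]] := cLI u.
  exists (l + l'), i; split; [exact: left_idealD | split=> // | by rewrite Eu addrA].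
  by rewrite /= (_ : i = u - l') ?rpredB // Eu addrC addKr.
have /eqP EWU : W == U by rewrite eqEdim sWU.
by apply: nIx; have [_] := (UW x).1 (eq_ind_r (fun V : {vspace R} => x \in V) LUx.2 EWU).
Qed.

End Artinian.

(** * Submodules for the scalars in [B] *)

Definition submodule (A : pzRingType) (B : {pred A}) (V : lmodType A)
    (W : set V) : Prop :=
  subgroup W /\ forall b x, b \in B -> W x -> W (b *: x).

Section Submodules.
Variables (A : pzRingType) (B : {pred A}) (V : lmodType A).
Implicit Types W U : set V.

Lemma submoduleD W x y : submodule B W -> W x -> W y -> W (x + y).
Proof.
move=> [[W0 WB] _] Wx Wy; rewrite -[y]opprK -[- y]sub0r.
by apply: (WB) => //; apply: WB.
Qed.

Definition complement W U : Prop :=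
  [/\ submodule B U, forall x, exists w u, [/\ W w, U u & x = w + u] &
      forall x, W x -> U x -> x = 0].

End Submodules.

Lemma ker_submodule (A : pzRingType) (B : {pred A}) (V V' : lmodType A)
  (f : {linear V -> V'}) : submodule B [set x | f x = 0].
Proof.
split; first split=> [|x y /= fx fy].
- exact: linear0.
- by rewrite linearB fx fy subr0.
- by move=> b x _ /= fx; rewrite linearZ_LR fx scaler0.
Qed.

Lemma rel_linearB (A : pzRingType) (B : {pred A}) (M N : lmodType A) (h : M -> N) :
  rel_linear B h -> {morph h : x y / x - y}.
Proof.
by move=> [hD _] x y; apply/eqP; rewrite eq_sym subr_eq -hD subrK.
Qed.

(** * [B]-linear splittings of modules killed by J(B) *)

Section Semisimple.
Variables (k : fieldType) (A : falgType k) (B : {aspace A}).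
Hypothesis B1 : 1 \in B.

Lemma vsval1 : vsval (1 : subvs_of B) = 1.
Proof. by apply/eqP; rewrite /= algid_eq1. Qed.

Lemma submodule_complement (V : lmodType A) (W : set V) :
    (forall j (x : V), jacobson_sub B j -> j *: x = 0) ->
  submodule B W -> exists U, complement B W U.
Proof.
move=> JV sW.
(* [P] does not ask for 0 in [U], because the union of the empty chain is empty; maximality supplies
   0 afterwards. *)
pose P (U : set V) := [/\ forall x y, U x -> U y -> U (x - y),
  forall b x, b \in B -> U x -> U (b *: x) & forall x, W x -> U x -> x = 0].
have [F FP totF|U [[UB UM WU] maxU]] := @Zorn_bigcup V P.
  split.
  - move=> x y [X FX Xx] [Y FY Yy].
    case: (totF X Y FX FY) => [XY|YX].
      by exists Y => //; case: (FP Y FY) => YB _ _; apply: YB => //; apply: XY.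
    by exists X => //; case: (FP X FX) => XB _ _; apply: XB => //; apply: YX.
  - by move=> b x Bb [X FX Xx]; exists X => //; case: (FP X FX) => _ XM _; apply: XM.
  - by move=> x Wx [X FX Xx]; case: (FP X FX) => _ _; apply.
have maxU' U' : P U' -> U `<=` U' -> U' `<=` U.
  by move=> PU' UU'; apply: contrapT => nU'U; case: (maxU U').
have U0 : U 0.
  pose Z : set V := U `|` [set 0].
  apply: (maxU' Z); last by right.
    split=> [x y [Ux|->] [Uy|->]|b x Bb [Ux|->]|x Wx [Ux|//]].
    - by left; apply: UB.
    - by left; rewrite subr0.
    - by left; rewrite -(subrr y); apply: (UB) => //; apply: UB.
    - by right; rewrite /= subrr.
    - by left; apply: UM.
    - by right; rewrite /= scaler0.
    - exact: WU.
  by move=> x; left.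
have sU : submodule B U by split.
exists U; split=> // v; apply: contrapT => nv.
pose WU' (x : V) := exists w u, [/\ W w, U u & x = w + u].
(* For [L'] complementing the ideal [L] of those [b] with [b v] in [W + U], the *)
(* module [U + L' v] still meets [W] trivially, so [L' v] lies in [U].          *)
pose L : set (subvs_of B) := [set b | WU' (vsval b *: v)].
have lL : left_ideal L.
  split; first split.
  - by exists 0, 0; split=> //; [case: sW.1 | rewrite addr0 scale0r].
  - move=> b c [w [u [Ww Uu bv]]] [w' [u' [Ww' Uu' cv]]].
    exists (w - w'), (u - u'); split; [exact: sW.1.2 | exact: UB |].
    by rewrite [vsval _]linearB scalerBl bv cv opprD addrACA.
  move=> a b [w [u [Ww Uu bv]]]; exists (vsval a *: w), (vsval a *: u).
  split; [by apply: sW.2 => //; apply: subvsP | by apply: UM => //; apply: subvsP |].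
  by rewrite -scalerDr -bv scalerA.
have [L' [lL' LL' LJ]] := left_ideal_complement lL.
pose U' : set V := [set x | exists u l, [/\ U u, L' l & x = u + vsval l *: v]].
have L'U l : L' l -> U (vsval l *: v).
  move=> L'l; apply: (maxU' U'); first last.
  - by exists 0, l; rewrite add0r.
  - by move=> u Uu; exists u, 0; split; [|case: lL'.1|rewrite scale0r addr0].
  split.
  - move=> _ _ [u [m [Uu Lm ->]]] [u' [m' [Uu' Lm' ->]]]; exists (u - u'), (m - m').
    split; [exact: UB | exact: lL'.1.2 |].
    by rewrite [vsval (m - m')]linearB scalerBl opprD addrACA.
  - move=> b _ Bb [u [m [Uu Lm ->]]]; exists (b *: u), (Subvs Bb * m).
    split; [exact: UM | exact: lL'.2 |].
    by rewrite scalerDr scalerA.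
  - move=> x Wx [u [m [Uu Lm Ex]]]; subst x.
    (* Here [m v] is an element of [W] minus one of [U], so [m] lies in both [L] and [L'], hence in
       the radical, and kills [v]. *)
    have Lm' : L m.
      exists (u + vsval m *: v), (- u); split=> //.
        by rewrite -sub0r; apply: UB.
      by rewrite addrC addKr.
    have mv0 : vsval m *: v = 0 by apply: JV; exists m => //; apply: LJ.
    by rewrite mv0 addr0 in Wx *; apply: WU.
(* With [1 = l + l'], the vector [v] is the sum of [l v] in [W + U] and [l' v] in [U]. *)
have [l [l' [Ll L'l' E1]]] := LL' 1.
apply: nv; case: Ll => w [u [Ww Uu lv]]; exists w, (u + vsval l' *: v).
split=> //; first by apply: (submoduleD sU) => //; apply: L'U.
have ll'1 : vsval l + vsval l' = 1 := etrans (esym (congr1 vsval E1)) vsval1.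
by rewrite addrA -lv -scalerDl ll'1 scale1r.
Qed.

(** [f] is bijective on a complement of its kernel, and [s] is the inverse; uniqueness of the
    preimage there makes it [B]-linear. *)
Lemma rel_linear_section (V V' : lmodType A) (f : {linear V -> V'}) :
    (forall j (x : V), jacobson_sub B j -> j *: x = 0) ->
    (forall y, exists x, f x = y) ->
  exists2 s : V' -> V, rel_linear B s & cancel s f.
Proof.
move=> JV fsurj.
have [U [sU kerU Uker]] := submodule_complement JV (ker_submodule B f).
have /choice[s sP] y : exists x, U x /\ f x = y.
  have [x <-] := fsurj y; have [w [u [/= fw Uu ->]]] := kerU x.
  by exists u; rewrite linearD fw add0r.
have sE y x : U x -> f x = y -> s y = x.
  move=> Ux fx; have [Us fs] := sP y; apply/eqP; rewrite -subr_eq0; apply/eqP.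
  by apply: Uker; [rewrite /= linearB fs fx subrr | apply: sU.1.2].
exists s => [|y]; last by case: (sP y).
split=> [x y|b x Bb]; apply: sE.
- exact: submoduleD sU (sP x).1 (sP y).1.
- by rewrite linearD (sP x).2 (sP y).2.
- exact: sU.2 Bb (sP x).1.
- by rewrite linearZ_LR (sP x).2.
Qed.

(** Split each term into cycles [Z n] and a complement [U n]. Then [d n] maps [U n.+1]
    isomorphically onto [Z n]; the homotopy is the inverse on [Z n] and 0 on [U n]. *)
Lemma exact_rel_exact (X : nat -> lmodType A) (d : forall n, {linear X n.+1 -> X n}) :
    (forall n j (x : X n), jacobson_sub B j -> j *: x = 0) ->
  is_exact d -> rel_exact B d.
Proof.
move=> JX [dd d0 dex]; split=> //.
(* At index 0 every element counts as a cycle, since [d 0] is onto. *)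
pose Z n : set (X n) :=
  if n is m.+1 return set (X n) then [set x | d m x = 0] else setT.
have sZ n : submodule B (Z n) by case: n => [|n]; [split | exact: ker_submodule].
have Zd n x : Z n (d n x) by case: n x => [|n] x //=; apply: dd.
have dZ n x : Z n x -> exists y, d n y = x.
  by case: n x => [|n] x Zx; [apply: d0 | apply: dex].
have Uex n : exists U, complement B (Z n) U by apply: submodule_complement; auto.
pose U n := sval (cid (Uex n)).
have UP n : complement B (Z n) (U n) := svalP (cid (Uex n)).
(* [h n x] is the unique [y] in [U n.+1] with [x - d n y] in [U n]. *)
have hex n (x : X n) : exists y, U n.+1 y /\ U n (x - d n y).
  have [sUn ZUn _] := UP n; have [_ ZUn1 _] := UP n.+1.
  have [z [u [Zz Uu ->]]] := ZUn x; have [y dy] := dZ n z Zz.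
  have [z' [u' [/= dz' Uu' Ey]]] := ZUn1 y.
  exists u'; split=> //; have -> : d n u' = z by rewrite -dy Ey linearD dz' add0r.
  by rewrite addrC addKr.
pose h n := projT1 (choice (hex n)).
have hP n x : U n.+1 (h n x) /\ U n (x - d n (h n x)) := projT2 (choice (hex n)) x.
have hE n x y : U n.+1 y -> U n (x - d n y) -> h n x = y.
  move=> Uy Uxy; have [Uh Uxh] := hP n x.
  have [sUn _ ZUn] := UP n; have [sUn1 _ ZUn1] := UP n.+1.
  apply/eqP; rewrite -subr_eq0; apply/eqP; apply: ZUn1; last exact: sUn1.1.2.
  apply: ZUn; first exact: Zd.
  rewrite linearB; have -> : d n (h n x) - d n y = x - d n y - (x - d n (h n x)).
    by rewrite opprB [RHS]addrC addrA subrK.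
  exact: sUn.1.2.
exists h; split=> [n|x|n x].
- have [sUn _ _] := UP n; have [sUn1 _ _] := UP n.+1.
  split=> [x y|b x Bb]; apply: hE.
  + exact: submoduleD sUn1 (hP n x).1 (hP n y).1.
  + by rewrite linearD opprD addrACA; apply: submoduleD sUn (hP n x).2 (hP n y).2.
  + exact: sUn1.2 Bb (hP n x).1.
  + by rewrite linearZ_LR -scalerBr; apply: sUn.2 => //; apply: (hP n x).2.
- have [_ _ Z0] := UP 0%N; have [_ Uxh] := hP 0%N x.
  by apply/eqP; rewrite eq_sym -subr_eq0; apply/eqP; apply: Z0.
(* The [U]-component of [x] has the same image under [d n] as [x], so it is [h n (d n x)]. *)
- have [_ Uxh] := hP n.+1 x; rewrite (hE n (d n x) (x - d n.+1 (h n.+1 x))) //.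
    by rewrite addrC subrK.
  have [sUn _ _] := UP n.
  by rewrite linearB dd subr0 subrr; case: sUn.1.
Qed.

End Semisimple.

(** * Inflation and reduction along A -> A/J *)

Lemma subgroup_gen_min (V : zmodType) (S G : set V) x :
  subgroup G -> S `<=` G -> x \in subgroup_gen S -> G x.
Proof. by move=> sG SG /asboolP; apply. Qed.

Lemma mem_subgroup_gen (V : zmodType) (S : set V) x : S x -> x \in subgroup_gen S.
Proof. by move=> Sx; apply/asboolP=> G _; apply. Qed.

Section ChangeOfRings.
Variables (A : pzRingType) (S : set A).
Local Notation C := (quotring S).

Definition quotring_pi (a : A) : C := \pi_C a.

Lemma quotring_piB : {morph quotring_pi : a b / a - b}.
Proof. by move=> a b; rewrite /quotring_pi pi_addr pi_oppr. Qed.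

Lemma quotring_piD : {morph quotring_pi : a b / a + b}.
Proof. exact: morphBD quotring_piB. Qed.

Lemma quotring_piM : {morph quotring_pi : a b / a * b}.
Proof. exact: pi_quotring_mul. Qed.

Lemma quotring_pi1 : quotring_pi 1 = 1.
Proof. by rewrite /quotring_pi [RHS]/(quotring_one S); unlock quotring_one. Qed.

Lemma quotring_piK (c : C) : quotring_pi (repr c) = c.
Proof. exact: reprK. Qed.

Lemma quotring_pi0 a : a \in ideal_gen S -> quotring_pi a = 0.
Proof.
rewrite -{1}[a]subr0 Quotient.idealrBE => /eqP; rewrite /quotring_pi => ->.
exact: (morphB0 quotring_piB).
Qed.

Lemma repr_quotring_pi a : repr (quotring_pi a) - a \in ideal_gen S.
Proof. by rewrite Quotient.idealrBE reprK. Qed.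

(** A copy of [N] under a new name, which carries the [A]-action separately from the [C]-action. *)
Definition inflation (N : lmodType C) : Type := N.

Section Inflation.
Variable N : lmodType C.

HB.instance Definition _ := GRing.Zmodule.on (inflation N).

Definition inflation_scale (a : A) (x : inflation N) : inflation N :=
  quotring_pi a *: (x : N).

Fact inflation_scaleA a b x :
  inflation_scale a (inflation_scale b x) = inflation_scale (a * b) x.
Proof. by rewrite /inflation_scale scalerA quotring_piM. Qed.

Fact inflation_scale1 : left_id 1 inflation_scale.
Proof. by move=> x; rewrite /inflation_scale quotring_pi1 scale1r. Qed.

Fact inflation_scaleDr : right_distributive inflation_scale +%R.
Proof. by move=> a x y; apply: scalerDr. Qed.

Fact inflation_scaleDl x : {morph inflation_scale^~ x : a b / a + b}.
Proof. by move=> a b; rewrite /inflation_scale quotring_piD scalerDl. Qed.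

HB.instance Definition _ := GRing.Zmodule_isLmodule.Build A (inflation N)
  inflation_scaleA inflation_scale1 inflation_scaleDr inflation_scaleDl.

Lemma inflationZ a (x : inflation N) : a *: x = quotring_pi a *: (x : N).
Proof. by []. Qed.

Lemma inflation_ideal j (x : inflation N) : j \in ideal_gen S -> j *: x = 0.
Proof. by move=> Sj; rewrite inflationZ quotring_pi0 // scale0r. Qed.

End Inflation.

Section InflationMap.
Variables (N N' : lmodType C) (f : {linear N -> N'}).

Definition inflation_map (x : inflation N) : inflation N' := f x.

Fact inflation_map_linear : linear inflation_map.
Proof. by move=> a x y; apply: (linearP f (quotring_pi a)). Qed.

HB.instance Definition _ :=
  GRing.isLinear.Build A (inflation N) (inflation N') *:%R inflation_map
    inflation_map_linear.

End InflationMap.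

(** * The reduction M/JM and its universal property *)

Section Reduction.
Variable M : lmodType A.

(** Bare products only; the submodule JM is the [subgroup_gen] of this set. *)
Definition ideal_action : set M :=
  [set x | exists j y, j \in ideal_gen S /\ x = j *: y].

Definition reduction := {ideal_quot (subgroup_gen ideal_action)}.

HB.instance Definition _ := GRing.Zmodule.on reduction.
HB.instance Definition _ := EqQuotient.on reduction.

Definition reduction_pi (x : M) : reduction := \pi_reduction x.

Definition reduction_scale (c : C) (u : reduction) : reduction :=
  reduction_pi (repr c *: repr u).

Lemma reduction_piB : {morph reduction_pi : x y / x - y}.
Proof. by move=> x y; rewrite /reduction_pi pi_addr pi_oppr. Qed.

Lemma reduction_piD : {morph reduction_pi : x y / x + y}.
Proof. exact: morphBD reduction_piB. Qed.

Lemma reduction_piK (u : reduction) : reduction_pi (repr u) = u.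
Proof. exact: reprK. Qed.

Lemma reduction_piP x y :
  reduction_pi x = reduction_pi y <-> x - y \in subgroup_gen ideal_action.
Proof. by rewrite Quotient.idealrBE; split=> /eqP. Qed.

Lemma reduction_pi0 x : reduction_pi x = 0 <-> x \in subgroup_gen ideal_action.
Proof. by rewrite -(morphB0 reduction_piB) reduction_piP subr0. Qed.

Lemma scale_ideal_action j x :
  j \in ideal_gen S -> j *: x \in subgroup_gen ideal_action.
Proof. by move=> Sj; apply: mem_subgroup_gen; exists j, x. Qed.

Lemma ideal_actionZ a x : x \in subgroup_gen ideal_action ->
  a *: x \in subgroup_gen ideal_action.
Proof.
apply: (@subgroup_gen_min _ _ [set x | a *: x \in subgroup_gen ideal_action]).
  by split=> [|y z /= Gy Gz]; rewrite /= ?scaler0 ?rpred0 // scalerBr rpredB.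
move=> _ [j [y [Sj ->]]] /=; rewrite scalerA scale_ideal_action //.
exact: ideal_genMl.
Qed.

Lemma reduction_scaleE a x :
  reduction_scale (quotring_pi a) (reduction_pi x) = reduction_pi (a *: x).
Proof.
apply/reduction_piP.
(* Change one representative at a time: first that of [x], then that of [a]. Each error lies in
   JM. *)
rewrite -(subrK (repr (quotring_pi a) *: x) (_ *: repr _)) -addrA -scalerBr -scalerBl.
apply: rpredD; last exact/scale_ideal_action/repr_quotring_pi.
by apply/ideal_actionZ/reduction_piP; rewrite reduction_piK.
Qed.

Fact reduction_scaleA a b u :
  reduction_scale a (reduction_scale b u) = reduction_scale (a * b) u.
Proof.
rewrite -[a]quotring_piK -[b]quotring_piK -[u]reduction_piK -quotring_piM.
by rewrite !reduction_scaleE scalerA.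
Qed.

Fact reduction_scale1 : left_id 1 reduction_scale.
Proof.
by move=> u; rewrite -[u]reduction_piK -quotring_pi1 reduction_scaleE scale1r.
Qed.

Fact reduction_scaleDr : right_distributive reduction_scale +%R.
Proof.
move=> a u v; rewrite -[a]quotring_piK -[u]reduction_piK -[v]reduction_piK.
by rewrite -reduction_piD !reduction_scaleE scalerDr reduction_piD.
Qed.

Fact reduction_scaleDl u : {morph reduction_scale^~ u : a b / a + b}.
Proof.
move=> a b; rewrite -[a]quotring_piK -[b]quotring_piK -[u]reduction_piK.
by rewrite -quotring_piD !reduction_scaleE scalerDl reduction_piD.
Qed.

HB.instance Definition _ := GRing.Zmodule_isLmodule.Build C reduction
  reduction_scaleA reduction_scale1 reduction_scaleDr reduction_scaleDl.

Lemma reduction_piZ a x : reduction_pi (a *: x) = quotring_pi a *: reduction_pi x.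
Proof. by rewrite -reduction_scaleE. Qed.

Definition reduction_unit (x : M) : inflation reduction := reduction_pi x.

Fact reduction_unit_linear : linear reduction_unit.
Proof. by move=> a x y; rewrite /reduction_unit reduction_piD reduction_piZ. Qed.

HB.instance Definition _ :=
  GRing.isLinear.Build A M (inflation reduction) *:%R reduction_unit
    reduction_unit_linear.

Section Lift.
Variables (N : lmodType C) (f : {linear M -> inflation N}).

(** The map that corresponds to [f] under the adjunction of reduction and inflation. *)
Definition reduction_lift (u : reduction) : N := f (repr u).

Lemma reduction_liftE x : reduction_lift (reduction_pi x) = f x.
Proof.
apply/eqP; rewrite -subr_eq0; apply/eqP.
have /reduction_piP : reduction_pi (repr (reduction_pi x)) = reduction_pi x.
  exact: reduction_piK.
rewrite -[reduction_lift _ - _]/(f _ - f x) -linearB.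
apply: (@subgroup_gen_min _ _ [set x | f x = 0]).
  split=> [|y z /= fy fz]; first exact: linear0.
  by rewrite linearB fy fz subr0.
by move=> _ [j [y [Sj ->]]] /=; rewrite linearZ_LR inflation_ideal.
Qed.

Fact reduction_lift_linear : linear reduction_lift.
Proof.
move=> c u v; rewrite -[c]quotring_piK -[u]reduction_piK -[v]reduction_piK.
by rewrite -reduction_piZ -reduction_piD !reduction_liftE linearP.
Qed.

HB.instance Definition _ :=
  GRing.isLinear.Build C reduction N *:%R reduction_lift reduction_lift_linear.

End Lift.
End Reduction.
End ChangeOfRings.

(** The ideal lies in [B], so a [B]-linear [h] satisfies [h (j y) = j (h y)] for [j] in it. *)
Lemma rel_linear_ideal_action (A : pzRingType) (B : {pred A}) (S : set A)
    (M N : lmodType A) (h : M -> N) x :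
    (forall j, j \in ideal_gen S -> j \in B) -> rel_linear B h ->
  x \in subgroup_gen (ideal_action S (M := M)) ->
  h x \in subgroup_gen (ideal_action S (M := N)).
Proof.
move=> SB h_lin; have hB := rel_linearB h_lin.
apply: (@subgroup_gen_min _ _
  [set x | h x \in subgroup_gen (ideal_action S (M := N))]).
  split=> [|y z /= Gy Gz]; rewrite /= ?(morphB0 hB) ?rpred0 //.
  by rewrite hB rpredB.
by move=> _ [j [y [Sj ->]]] /=; rewrite h_lin.2 ?SB // scale_ideal_action.
Qed.

(** * Relative projectivity *)

Section TensorExtension.
Variables (A : pzRingType) (B : {pred A}) (M N : lmodType A) (f : M -> N).
Hypothesis f_lin : rel_linear B f.

Local Notation F := {freeg (A * M)%type / int}.
Local Notation gen a m := (<< ((a, m) : A * M) >> : F).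

Definition pretensor_ext : F -> N :=
  fglift (fun p : A * M => p.1 *: f p.2 : zmodule N).

Definition tensor_ext (t : tensor B M) : N := pretensor_ext (repr t).

Let preB : {morph pretensor_ext : x y / x - y}.
Proof. exact: (@lift_is_additive _ _ (zmodule N)). Qed.

Let preE a m : pretensor_ext (gen a m) = a *: f m.
Proof. by rewrite /pretensor_ext liftU scale1r. Qed.

Let pre_rel x : x \in subgroup_gen (tensor_rel B (M := M)) -> pretensor_ext x = 0.
Proof.
apply: (@subgroup_gen_min _ _ [set x | pretensor_ext x = 0]).
  split=> [|y z /= fy fz]; first exact: morphB0 preB.
  by rewrite preB fy fz subr0.
move=> r /=; case=> [[b [b' [m ->]]]|[b [m [m' ->]]]|[b [c [m [Bc ->]]]]];
  rewrite preB ?(morphBD preB) !preE.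
- by rewrite scalerDl subrr.
- by rewrite f_lin.1 scalerDr subrr.
- by rewrite f_lin.2 // scalerA subrr.
Qed.

Let ext_pi x : tensor_ext (\pi_(tensor B M) x) = pretensor_ext x.
Proof.
apply/esym/eqP; rewrite -subr_eq0 -preB pre_rel //.
by rewrite Quotient.idealrBE reprK.
Qed.

Lemma tensor_extE a m : tensor_ext (ptensor B a m) = a *: f m.
Proof. by rewrite ext_pi preE. Qed.

Let extB : {morph tensor_ext : x y / x - y}.
Proof.
move=> x y; rewrite -[x]reprK -[y]reprK.
have <- : \pi_(tensor B M) (repr x - repr y) =
    \pi_(tensor B M) (repr x) - \pi_(tensor B M) (repr y).
  by rewrite pi_addr pi_oppr.
by rewrite !ext_pi preB.
Qed.

Fact tensor_ext_linear : linear tensor_ext.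
Proof.
move=> a x y; rewrite (morphBD extB); congr (_ + _).
apply: (@tensor_eq _ _ _ _ (tensor_ext \o ( *:%R a)) (fun t => a *: tensor_ext t)).
- by move=> u v /=; rewrite scalerBr extB.
- by move=> u v; rewrite extB scalerBr.
- by move=> c m /=; rewrite [_ *: _]tensor_scaleE !tensor_extE scalerA.
Qed.

Lemma tensor_ext_ex :
  exists g : {linear tensor B M -> N}, forall a m, g (ptensor B a m) = a *: f m.
Proof.
pose m := GRing.isLinear.Build A (tensor B M) N *:%R tensor_ext tensor_ext_linear.
pose g : {linear tensor B M -> N} := HB.pack tensor_ext m.
by exists g => a x; apply: tensor_extE.
Qed.

End TensorExtension.

(** * Induced modules and their reduction *)

Section Tensor.
Variables (A : pzRingType) (B : {pred A}) (S : set A) (M : lmodType A).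
Local Notation T := (tensor B M).

Lemma linear_tensor_eq (N : lmodType A) (f g : {linear T -> N}) :
  (forall a m, f (ptensor B a m) = g (ptensor B a m)) -> f =1 g.
Proof. by move=> fg; apply: tensor_eq => // x y; apply: linearB. Qed.

Hypothesis SB : forall j, j \in ideal_gen S -> j \in B.

Lemma ptensor1_linear : rel_linear B (ptensor B (M := M) 1).
Proof.
split=> [x y|b x Bb]; first exact: ptensorDr.
by rewrite -ptensorM // mul1r [RHS]tensor_scaleE mulr1.
Qed.

Let ptensorB : {morph ptensor B (M := M) 1 : x y / x - y}.
Proof. exact: rel_linearB ptensor1_linear. Qed.

(** On a pure tensor of [a] and [m], the product [j a] is again in the ideal, hence in [B], and
    moves across the tensor sign. *)
Lemma ideal_tensor j (t : T) :
  j \in ideal_gen S -> j *: t = ptensor B 1 (j *: tensor_mul t).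
Proof.
move=> Sj; apply: (@tensor_eq _ _ _ _ ( *:%R j)
  (fun t => ptensor B 1 (j *: tensor_mul t))) => [x y|x y|a m].
- exact: scalerBr.
- by rewrite linearB scalerBr ptensorB.
- rewrite [LHS]tensor_scaleE tensor_mulE scalerA -[in LHS](mul1r (j * a)).
  by rewrite ptensorM //; apply/SB/ideal_genMr.
Qed.

(** In other words, multiplication is injective on JT. *)
Lemma ideal_action_tensor (t : T) :
  t \in subgroup_gen (ideal_action S (M := T)) -> t = ptensor B 1 (tensor_mul t).
Proof.
apply: (@subgroup_gen_min _ _ [set t | t = ptensor B 1 (tensor_mul t)]).
  split=> [|x y /= Ex Ey]; first by rewrite /= linear0 (morphB0 ptensorB).
  by rewrite /= linearB ptensorB -Ex -Ey.
by move=> _ [j [t' [Sj ->]]] /=; rewrite linearZ_LR -ideal_tensor.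
Qed.

(* The square formed by [T -> M], [T -> T/JT], [M -> P] and [T/JT -> P] is a   *)
(* pullback, so a section of [T/JT -> P] induces one of [T -> M].              *)
Lemma rel_projective_lift (P : lmodType (quotring S))
    (p : {linear M -> inflation P}) : projective P ->
    (forall y, exists x, p x = y) ->
    (forall x, p x = 0 -> x \in subgroup_gen (ideal_action S (M := M))) ->
  rel_projective B M.
Proof.
move=> projP p_surj p_ker.
pose q : {linear T -> inflation P} := p \o @tensor_mul A B M.
have q_surj y : exists u, reduction_lift q u = y.
  have [x <-] := p_surj y; exists (reduction_pi S (ptensor B 1 x)).
  by rewrite reduction_liftE /= tensor_mulE scale1r.
have [s sP] := projP _ _ (reduction_lift q) idfun q_surj.
(* Such [t] and [t'] differ by an element of JT that multiplies to 0. This uniqueness later yields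
   the linearity of [f]. *)
have uniq (t t' : T) : reduction_pi S t = reduction_pi S t' ->
    tensor_mul t = tensor_mul t' -> t = t'.
  move=> /reduction_piP/ideal_action_tensor Et mut.
  apply/eqP; rewrite -subr_eq0 Et linearB /= mut subrr.
  by rewrite (morphB0 ptensorB).
have /choice[f fP] m : exists t : T, reduction_pi S t = s (p m) /\ tensor_mul t = m.
  (* Any lift [t] multiplies to [m] up to an error in JM. Its tensor with 1 lies in JT, so
     subtracting it corrects the product and keeps the class. *)
  pose t := repr (s (p m)); have Et : reduction_pi S t = s (p m) := reprK _.
  exists (t - ptensor B 1 (tensor_mul t - m)); split; last first.
    by rewrite linearB /= tensor_mulE scale1r subKr.
  rewrite reduction_piB Et; set x := tensor_mul t - m.
  have -> : reduction_pi S (ptensor B 1 x) = 0; last by rewrite subr0.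
  apply/reduction_pi0/(rel_linear_ideal_action SB ptensor1_linear)/p_ker.
  rewrite linearB.
  apply/eqP; rewrite subr_eq0; apply/eqP.
  have := sP (p m); rewrite -Et; apply: etrans; apply: esym (reduction_liftE q t).
have f_lin : linear f.
  move=> a x y; apply: uniq.
    rewrite (fP _).1 reduction_piD reduction_piZ !(fP _).1 -linearP.
    by congr (s _); rewrite linearP.
  by rewrite linearP /= !(fP _).2.
pose mf := GRing.isLinear.Build A M T *:%R f f_lin.
pose g : {linear M -> T} := HB.pack f mf.
by exists g => x; apply: (fP x).2.
Qed.

(* [s] embeds [M] in the module [T] induced from [B], and [B]-linear liftings  *)
(* extend to [T].                                                              *)
Lemma projective_reduction :
    (forall (N N' : lmodType A) (g : {linear N -> N'}),
       (forall j (x : N), j \in ideal_gen S -> j *: x = 0) ->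
       (forall y, exists x, g x = y) ->
     exists2 s : N' -> N, rel_linear B s & cancel s g) ->
  rel_projective B M -> projective (reduction S M).
Proof.
move=> Bsplit [s sK] N N' g f g_surj.
have [r r_lin rK] :=
  Bsplit _ _ (inflation_map g) (fun j x => @inflation_ideal A S N j x) g_surj.
pose fM : {linear M -> inflation N'} :=
  inflation_map f \o reduction_unit S (M := M).
(* [r] is only [B]-linear, but [r \o fM] extends to an [A]-linear map on [T]; composing with [s]
   brings it back to [M], and it then descends to the reduction. *)
have rf_lin : rel_linear B (r \o fM).
  split=> [x y|b x Bb] /=; first by rewrite !linearD r_lin.1.
  by rewrite !linearZ_LR r_lin.2.
have [h hE] := tensor_ext_ex rf_lin.
pose h' : {linear M -> inflation N} := h \o s.
exists (reduction_lift h') => u; rewrite -[in RHS](reduction_piK u) -(sK (repr u)).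
pose gh : {linear T -> inflation N'} := inflation_map g \o h.
pose fm : {linear T -> inflation N'} := fM \o @tensor_mul A B M.
apply: (@linear_tensor_eq _ gh fm) => a m.
rewrite /gh /fm /= hE tensor_mulE !linearZ_LR; congr (_ *: _).
exact: rK.
Qed.

End Tensor.

(** * Finite generation *)

Section FiniteGeneration.
Variable R : pzRingType.

(** Generation as an induction principle, which transfers along maps without families of
    coefficients. *)
Lemma fin_genP (M : lmodType R) : fin_gen M <->
  exists s : seq M, forall G : set M, G 0 ->
    (forall a x y, G x -> G y -> G (a *: x + y)) ->
    (forall x, x \in s -> G x) -> forall x, G x.
Proof.
split=> [[s sP]|[s sP]]; exists s.
  move=> G G0 GP Gs x; have [c ->] := sP x.
  elim/big_ind: _ => [//|u v Gu Gv|i _]; first by rewrite -[u]scale1r; apply: GP.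
  by rewrite -[_ *: _]addr0; apply: GP => //; apply/Gs/mem_nth.
apply: sP => [|a x y [c ->] [c' ->]|x xs].
- by exists (fun=> 0); rewrite big1 // => i _; rewrite scale0r.
- exists (fun i => a * c i + c' i); rewrite scaler_sumr -big_split /=.
  by apply: eq_bigr => i _; rewrite scalerDl scalerA.
- pose i0 := Ordinal (etrans (index_mem x s) xs : (index x s < size s)%N).
  exists (fun i => (i == i0)%:R); rewrite (bigD1 i0) //= eqxx scale1r nth_index //.
  by rewrite big1 ?addr0 // => i /negPf ->; rewrite scale0r.
Qed.

(** Images of generators of [L] together with chosen preimages of generators of [N] generate [M]. *)
Lemma fin_gen_extension (L M N : lmodType R) (f : {linear L -> M})
    (g : {linear M -> N}) :
    (forall y, exists x, g x = y) -> (forall x, g x = 0 -> exists y, f y = x) ->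
  fin_gen L -> fin_gen N -> fin_gen M.
Proof.
move=> g_surj g_ker /fin_genP[s sP] /fin_genP[t tP].
have /choice[h hP] := g_surj.
apply/fin_genP; exists (map f s ++ map h t) => G G0 GP Gst.
have GL x : G (f x).
  apply: (sP [set x | G (f x)]) => [|a y z /= Gy Gz|y sy] /=.
  - by rewrite linear0.
  - by rewrite linearP; apply: GP.
  - by apply: Gst; rewrite mem_cat map_f.
have GN y : exists x, G x /\ g x = y.
  apply: (tP [set y | exists x, G x /\ g x = y])
    => [|a u v /= [x [Gx <-]] [x' [Gx' <-]]|u tu] /=.
  - by exists 0; rewrite linear0.
  - by exists (a *: x + x'); rewrite linearP; split=> //; apply: GP.
  - by exists (h u); split=> //; apply: Gst; rewrite mem_cat map_f ?orbT.
move=> x; have [x' [Gx' gx']] := GN (g x).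
have [|y fy] := g_ker (x - x'); first by rewrite linearB gx' subrr.
by rewrite -(subrK x' x) -fy -[f y]scale1r; apply: GP.
Qed.

End FiniteGeneration.

Section FinGenChange.
Variables (A : pzRingType) (S : set A).

Lemma fin_gen_reduction (M : lmodType A) : fin_gen M -> fin_gen (reduction S M).
Proof.
move=> /fin_genP[s sP]; apply/fin_genP; exists (map (@reduction_pi A S M) s).
move=> G G0 GP Gs u.
rewrite -[u]reduction_piK; move: (repr u).
apply: (sP [set x | G (reduction_pi S x)]) => [|a x y /= Gx Gy|x sx] /=.
- by rewrite (morphB0 (@reduction_piB _ _ _)).
- by rewrite reduction_piD reduction_piZ; apply: GP.
- by apply: Gs; rewrite map_f.
Qed.

Lemma fin_gen_inflation (N : lmodType (quotring S)) : fin_gen N -> fin_gen (inflation N).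
Proof.
move=> /fin_genP[s sP]; apply/fin_genP; exists s => G G0 GP Gs.
apply: sP => // c x y; rewrite -[c]quotring_piK; exact: GP.
Qed.

End FinGenChange.

(** * The fibre product of P and M over M/JM *)

Section FibreProduct.
Variables (A : pzRingType) (S : set A) (M : lmodType A) (P : lmodType (quotring S)).
Variable d : {linear P -> reduction S M}.

Definition fibre_pred : {pred (inflation P * M)%type} :=
  fun x => d x.1 == reduction_pi S x.2.

Fact fibre_pred_closed : subsemimod_closed fibre_pred.
Proof.
split; first split.
- by rewrite /fibre_pred /in_mem /= linear0 (morphB0 (@reduction_piB _ _ _)).
- move=> x y /eqP dx /eqP dy; apply/eqP.
  by rewrite /= [d _]linearD dx dy reduction_piD.
- move=> a x /eqP dx; apply/eqP.
  by rewrite /= inflationZ linearZ_LR dx reduction_piZ.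
Qed.

HB.instance Definition _ :=
  GRing.isSubmodClosed.Build A (inflation P * M)%type fibre_pred fibre_pred_closed.

Record fibre_product :=
  FibreProduct { fibre_val : inflation P * M; _ : fibre_val \in fibre_pred }.

HB.instance Definition _ := [isSub for fibre_val].
HB.instance Definition _ := [Choice of fibre_product by <:].
HB.instance Definition _ := [SubChoice_isSubLmodule of fibre_product by <:].

Lemma fibre_productP (x : fibre_product) : d (val x).1 = reduction_pi S (val x).2.
Proof. by apply/eqP; apply: (valP x). Qed.

Definition fibre_fst (x : fibre_product) : inflation P := (val x).1.
Definition fibre_snd (x : fibre_product) : M := (val x).2.

Fact fibre_fst_linear : linear fibre_fst. Proof. by []. Qed.
Fact fibre_snd_linear : linear fibre_snd. Proof. by []. Qed.

HB.instance Definition _ :=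
  GRing.isLinear.Build A fibre_product (inflation P) *:%R fibre_fst fibre_fst_linear.
HB.instance Definition _ :=
  GRing.isLinear.Build A fibre_product M *:%R fibre_snd fibre_snd_linear.

Lemma fibre_fst_surj y : exists x, fibre_fst x = y.
Proof.
have yP : (y, repr (d y)) \in fibre_pred by apply/eqP; rewrite /= reduction_piK.
by exists (FibreProduct yP).
Qed.

(** If [d z] is the class of [y], then [(0, j y) = j (z, y)], because [j] kills the inflated [P].
    Hence the kernel of the first projection of the fibre product Q is JQ. *)
Lemma fibre_ideal x : fibre_snd x \in subgroup_gen (ideal_action S (M := M)) ->
  (forall y, exists z, d z = y) -> fibre_fst x = 0 ->
  x \in subgroup_gen (ideal_action S (M := fibre_product)).
Proof.
move=> x2 d_surj x1.
suff /(_ _ x2)[y [yG y1 y2]] : forall m, m \in subgroup_gen (ideal_action S (M := M)) ->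
  exists y, [/\ y \in subgroup_gen (ideal_action S (M := fibre_product)),
                fibre_fst y = 0 & fibre_snd y = m].
  suff -> : x = y by [].
  apply/val_inj; rewrite [LHS]surjective_pairing [RHS]surjective_pairing.
  by congr (_, _); [apply: etrans x1 (esym y1) | apply: esym].
move=> m {x x1 x2}; pose G := [set m | exists y,
  [/\ y \in subgroup_gen (ideal_action S (M := fibre_product)),
                fibre_fst y = 0 & fibre_snd y = m]].
apply: (@subgroup_gen_min _ _ G).
  split=> [|_ _ [y [yG y1 <-]] [z [zG z1 <-]]].
    by exists 0; rewrite rpred0 !linear0.
  by exists (y - z); rewrite rpredB // !linearB /= y1 z1 subr0.
move=> _ [j [y [Sj ->]]]; have [z dz] := d_surj (reduction_pi S y).
have zP : (z, y) \in fibre_pred by apply/eqP.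
exists (j *: FibreProduct zP).
split; [exact: scale_ideal_action | | by rewrite linearZ_LR].
by rewrite linearZ_LR; apply: inflation_ideal.
Qed.

End FibreProduct.

(** * Comparison of resolutions *)

Lemma enat_inf_le (E : set nat) n :
  enat_le (enat_inf E) n <-> exists2 m, (m <= n)%N & E m.
Proof.
rewrite /enat_inf; case: pselect => [exE|nE] /=; last first.
  by split=> // -[m _ Em]; case: nE; exists m; apply/asboolP.
have [m /asboolP Em m_min] := ex_minnP exE.
split=> [mn|[m' m'n Em']]; first by exists m.
by apply: leq_trans m'n; apply: m_min; apply/asboolP.
Qed.

(** Vanishing beyond [m] implies vanishing beyond any larger [n], so admissible lengths are upward
    closed. *)
Lemma proj_dim_le (R : pzRingType) proj exact (M : lmodType R) n :
  enat_le (proj_dim proj exact M) n <->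
  exists P, is_resolution proj exact M P /\ forall i, (n < i)%N -> forall x : P i, x = 0.
Proof.
rewrite enat_inf_le; split=> [[m mn [P [resP P0]]]|nP]; last by exists n.
by exists P; split=> // i ni; apply: P0; apply: leq_ltn_trans ni.
Qed.

(** A supremum is determined by its finite upper bounds, so the two rings are compared through
    uniform bounds. *)
Lemma global_dim_eq (R R' : pzRingType) proj exact proj' exact' :
    (forall n, (forall M : lmodType R, fin_gen M -> enat_le (proj_dim proj exact M) n) <->
      (forall M : lmodType R', fin_gen M -> enat_le (proj_dim proj' exact' M) n)) ->
  global_dim proj exact = global_dim proj' exact'.
Proof.
move=> le_iff; congr enat_inf; apply/seteqP; split=> n /= le_n x [M fgM ->].
  by apply: (le_iff n).1 M fgM => M fgM; apply: le_n; exists M.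
by apply: (le_iff n).2 M fgM => M fgM; apply: le_n; exists M.
Qed.

Section FibreInclusion.
Variables (A : pzRingType) (S : set A) (M : lmodType A).
Variables (P Q : lmodType (quotring S)) (d : {linear P -> reduction S M}).
Variables (f : {linear Q -> P}) (df : forall x, d (f x) = 0).

Fact fibre_incl_subproof (x : inflation Q) :
  (inflation_map f x, 0) \in fibre_pred d.
Proof.
apply/eqP; rewrite /= (morphB0 (@reduction_piB _ _ _)); exact: df.
Qed.

Definition fibre_incl (x : inflation Q) : fibre_product d :=
  FibreProduct (fibre_incl_subproof x).

Fact fibre_incl_linear : linear fibre_incl.
Proof.
move=> a x y; apply/val_inj.
rewrite [LHS]surjective_pairing [RHS]surjective_pairing.
by congr (_, _) => /=; [apply: linearP | rewrite scaler0 addr0].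
Qed.

HB.instance Definition _ :=
  GRing.isLinear.Build A (inflation Q) (fibre_product d) *:%R fibre_incl
    fibre_incl_linear.

End FibreInclusion.

(** * Reducing a relative resolution modulo the ideal *)

Section ReductionOfResolution.
Variables (A : pzRingType) (B : {pred A}) (S : set A) (N : lmodType (quotring S)).
Variables (P : nat -> lmodType A).
Variable d : forall n, {linear augment (inflation N) P n.+1 -> augment (inflation N) P n}.
Hypothesis SB : forall j, j \in ideal_gen S -> j \in B.

(** The case split arises because the resolved module [N], at index 0, is already over the quotient
    ring and is not reduced. *)
Definition reduced_diff n :
    {linear augment N (fun i => reduction S (P i)) n.+1 ->
            augment N (fun i => reduction S (P i)) n} :=
  match n with
  | 0 => reduction_lift (d 0%N)
  | m.+1 => reduction_lift (reduction_unit S (M := P m) \o d m.+1)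
  end.

Lemma reduced_exact : rel_exact B d -> is_exact reduced_diff.
Proof.
move=> [dd [h [hB h0 hd]]].
have dE m (x : P m.+1) :
    reduced_diff m.+1 (reduction_pi S x) = reduction_pi S (d m.+1 x).
  exact: (reduction_liftE (reduction_unit S (M := P m) \o d m.+1)).
have d0E (x : P 0%N) : reduced_diff 0 (reduction_pi S x) = d 0%N x.
  exact: (reduction_liftE (d 0%N)).
(* From [x - d (h x) = h (d x)]: if [d x] lies in the ideal times its module, so does [h (d x)], and
   [x] is a boundary modulo the ideal. *)
have hex m (x : P m) :
    d m x \in subgroup_gen (ideal_action S (M := augment (inflation N) P m)) ->
  exists y, reduction_pi S (d m.+1 y) = reduction_pi S x.
  move=> dx; exists (h m.+1 x); apply/reduction_piP.
  rewrite -{2}(hd m x) opprD addrA subrr sub0r rpredN.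
  exact: rel_linear_ideal_action SB (hB m) dx.
split=> [[|n] x|x|[|n] x].
- rewrite -[x]reduction_piK dE d0E; exact: (dd 0%N).
- rewrite -[x]reduction_piK !dE dd; exact: (morphB0 (@reduction_piB _ _ _)).
- by exists (reduction_pi S (h 0%N x)); rewrite d0E h0.
- rewrite -[x]reduction_piK d0E => dx.
  have [|y Ey] := hex 0%N (repr x); first by rewrite /= dx rpred0.
  by exists (reduction_pi S y); rewrite dE.
- rewrite -[x]reduction_piK dE => /reduction_pi0 dx.
  have [|y Ey] := hex n.+1 (repr x); first by [].
  by exists (reduction_pi S y); rewrite dE.
Qed.

End ReductionOfResolution.

(** * Lifting a resolution of M/JM to a relative resolution of M *)

Section FibreResolution.
Variables (A : pzRingType) (B : {pred A}) (S : set A) (M : lmodType A).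
Variables (P : nat -> lmodType (quotring S)).
Variable d : forall n,
  {linear augment (reduction S M) P n.+1 -> augment (reduction S M) P n}.
Hypothesis d_exact : is_exact d.

Definition fibre_res n : lmodType A :=
  if n is m.+1 then inflation (P m.+1) else fibre_product (d 0%N).

Let dd1 (x : P 1%N) : d 0%N (d 1%N x) = 0.
Proof. by case: d_exact. Qed.

Definition fibre_diff n : {linear augment M fibre_res n.+1 -> augment M fibre_res n} :=
  match n with
  | 0 => @fibre_snd _ _ _ _ (d 0%N)
  | 1 => fibre_incl dd1
  | m.+2 => inflation_map (d m.+2)
  end.

Lemma fibre_snd_surj (y : M) : exists x : fibre_res 0, fibre_snd x = y.
Proof.
case: d_exact => _ d0 _; have [x dx] := d0 (reduction_pi S y).
have xyP : (x, y) \in fibre_pred (d 0%N) by apply/eqP.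
by exists (FibreProduct xyP).
Qed.

Lemma fibre_snd_ker (x : fibre_res 0) :
  fibre_snd x = 0 -> exists y, fibre_incl dd1 y = x.
Proof.
case: d_exact => _ _ d_ex x0.
have [|y dy] := d_ex 0%N (fibre_fst x).
  rewrite [LHS]fibre_productP [(val x).2]x0.
  exact: (morphB0 (@reduction_piB _ _ _)).
exists y; apply/val_inj; rewrite [LHS]surjective_pairing [RHS]surjective_pairing.
by congr (_, _); [apply: dy | apply: esym].
Qed.

Lemma fibre_res_fin_gen i :
  fin_gen M -> (forall i, fin_gen (P i)) -> fin_gen (fibre_res i).
Proof.
move=> fgM fgP; case: i => [|i]; last exact: fin_gen_inflation.
(* The fibre product is an extension of [M] by the image of [P 1]. *)
apply: fin_gen_extension (fin_gen_inflation (fgP 1%N)) fgM.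
- exact: fibre_snd_surj.
- exact: fibre_snd_ker.
Qed.

Lemma fibre_res_rel_projective i : (forall j, j \in ideal_gen S -> j \in B) ->
  (forall i, projective (P i)) -> rel_projective B (fibre_res i).
Proof.
move=> SB projP; case: i => [|i].
  apply: (rel_projective_lift SB (p := @fibre_fst _ _ _ _ (d 0%N)) (projP 0%N)).
    exact: fibre_fst_surj.
  move=> x x1; apply: fibre_ideal => //; last by case: d_exact.
  apply/reduction_pi0; rewrite -[LHS]fibre_productP [(val x).1]x1; exact: linear0.
(* In positive degree the ideal acts by zero, so the identity serves as the reduction map. *)
apply: (rel_projective_lift SB (p := idfun) (projP i.+1)) => [y|x /= ->].
  by exists y.
exact: rpred0.
Qed.

Lemma fibre_rel_exact :
    rel_exact B (X := fun n => inflation (augment (reduction S M) P n))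
      (fun n => inflation_map (d n)) ->
  rel_exact B fibre_diff.
Proof.
move=> [dd [h [hB h0 hd]]].
have hP (m : M) : (h 0%N (reduction_pi S m), m) \in fibre_pred (d 0%N).
  by apply/eqP; apply: h0.
(* [M] goes into the fibre product by [h 0] of the class in the first component and the identity in
   the second; the next map sees only the first component. *)
pose h' n : augment M fibre_res n -> augment M fibre_res n.+1 :=
  match n with
  | 0 => fun m => FibreProduct (hP m)
  | 1 => fun x => h 1%N (fibre_fst x)
  | m.+2 => fun x => h m.+2 x
  end.
split.
  case=> [|[|n]] x //=.
  - apply/val_inj; rewrite [LHS]surjective_pairing.
    by congr (_, _); apply: (dd 1%N).
  - exact: (dd n.+2).
exists h'; split=> [[|[|n]]|//|[|[|n]] x].
- split=> [x y|b x Bb]; apply/val_inj;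
    rewrite [LHS]surjective_pairing [RHS]surjective_pairing; congr (_, _).
  + rewrite /= reduction_piD; exact: (hB 0%N).1.
  + rewrite /= reduction_piZ; exact: (hB 0%N).2.
- by split=> [x y|b x Bb]; [apply: (hB 1%N).1 | apply: (hB 1%N).2].
- exact: (hB n.+2).
(* The first component is the old homotopy identity, as the class of [fibre_snd x] is [d 0] of
   [fibre_fst x]. *)
- apply/val_inj; rewrite [LHS]surjective_pairing [RHS]surjective_pairing.
  congr (_, _); last exact: add0r.
  rewrite -[RHS](hd 0%N); congr (_ + h 0%N _).
  exact/esym/fibre_productP.
- exact: (hd 1%N).
- exact: (hd n.+2).
Qed.

End FibreResolution.

(** Semisimplicity of B/J(B) enters through the two splitting hypotheses. A bound [n] passes in both
    directions because both constructions keep the terms above degree [n] zero. *)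
Lemma rel_gldim_quotring (A : pzRingType) (B : {pred A}) (S : set A) :
    (forall j, j \in ideal_gen S -> j \in B) ->
    (forall (V V' : lmodType A) (f : {linear V -> V'}),
       (forall j (x : V), j \in ideal_gen S -> j *: x = 0) ->
       (forall y, exists x, f x = y) ->
     exists2 s : V' -> V, rel_linear B s & cancel s f) ->
    (forall (X : nat -> lmodType A) (d : forall n, {linear X n.+1 -> X n}),
       (forall n j (x : X n), j \in ideal_gen S -> j *: x = 0) ->
     is_exact d -> rel_exact B d) ->
  rel_gldim B = gldim (quotring S).
Proof.
move=> SB Bsplit Bexact; apply: global_dim_eq => n; split=> le_n M fgM.
  have /proj_dim_le[P [[fgP [d d_exact]] P0]] := le_n _ (fin_gen_inflation fgM).
  apply/proj_dim_le; exists (fun i => reduction S (P i)); split; last first.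
    move=> i ni x; rewrite -[x]reduction_piK (P0 i ni (repr x)).
    exact: (morphB0 (@reduction_piB _ _ _)).
  split=> [i|].
    have [fgPi projPi] := fgP i; split; first exact: fin_gen_reduction.
    exact: projective_reduction projPi.
  by exists (reduced_diff d); apply: reduced_exact d_exact.
have /proj_dim_le[P [[fgP [d d_exact]] P0]] := le_n _ (fin_gen_reduction S fgM).
apply/proj_dim_le; exists (fibre_res d); split; last first.
  (* Only degrees above [n], hence positive ones, must vanish, and there the terms are those of [P];
     the enlarged term sits in degree 0. *)
  by case=> [//|i] ni x; apply: P0 ni x.
split=> [i|].
  split; first by apply: fibre_res_fin_gen => // j; case: (fgP j).
  by apply: fibre_res_rel_projective => // j; case: (fgP j).
exists (fibre_diff d_exact); apply: fibre_rel_exact; apply: Bexact.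
  by move=> m j x; apply: inflation_ideal.
by case: d_exact.
Qed.

Theorem theorem3p21 (k : fieldType) (A : falgType k) (B : {aspace A}) :
  perfect_field k ->
  (1 : A) \in B ->
  two_sided_ideal (jacobson_sub B) ->
  controllable B.
Proof.
move=> _ B1 JA.
(* J(B) is already a two-sided ideal of [A], so it equals the ideal it generates. *)
have JE j : j \in ideal_gen (jacobson_sub B) <-> jacobson_sub B j.
  split=> [/asboolP|Jj]; first by apply.
  by apply/asboolP=> I _; apply.
apply: rel_gldim_quotring => [j /JE[b _ <-]|V V' f JV|X d JX].
- exact: subvsP.
- by apply: rel_linear_section => // j x /JE; apply: JV.
- by apply: exact_rel_exact => // n j x /JE; apply: JX.
Qed.
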